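(* Let $\mathbf{A},\mathbf{B}$ be conducts with disjoint carriers. If $\mathfrak{f}$ is a successful project in $\mathbf{A}\multimap\mathbf{B}$ and $\mathfrak{a}$ is a successful project in $\mathbf{A}$, then $\mathfrak{f}::\mathfrak{a}$ is a successful project.
   Context: Graphs. A directed weighted graph is a tuple $G=(V_G,E_G,s_G,t_G,\omega_G)$. Here $V_G$ is a finite vertex set, $E_G$ is a finite or countable edge set, $s_G,t_G$ are the source and target maps, and $\omega_G:E_G\to(0,1]$ gives the weights; $E_G(v,w)$ denotes the edges from $v$ to $w$. Paths are finite sequences of consecutive edges, with weight the product of weights; cycles are closed paths. A $1$-cycle is a cycle not of the form $\rho^k$ with $k\ge2$. A $1$-circuit is the class of a $1$-cycle under cyclic permutation. - $G\cup H$ has vertex set $V_G\cup V_H$ and edge set $E_G\sqcup E_H$, with edges coloured by origin. - Alternating paths alternate colours. Alternating cycles additionally have first and last edges of different colours. $\mathrm{Cycl}(G,H)$ is the set of alternating $1$-circuits. - $G::H$ has vertex set $V_G\triangle V_H$; its edges are the alternating paths with endpoints in $V_G\triangle V_H$, carrying their source, target and weight. - $\langle G,H\rangle=\sum_{\pi\in\mathrm{Cycl}(G,H)}-\log(1-\omega(\pi))$, with $-\log0=\infty$. Projects. - A project is $(a,A)$ with $a\in[0,\infty)$ and $A$ a graph; its carrier is $V_A$. - $\langle\!\langle\mathfrak{a},\mathfrak{b}\rangle\!\rangle=a+b+\langle A,B\rangle$. Projects of the same carrier are orthogonal if this is $\notin\{0,\infty\}$. - $S^\perp$ is the set of projects orthogonal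 to all elements of $S$. A conduct is a nonempty set of projects of a common carrier with $\mathbf{A}=\mathbf{A}^{\perp\perp}$. - When $\langle\!\langle\mathfrak{f},\mathfrak{g}\rangle\!\rangle\ne\infty$, $\mathfrak{f}::\mathfrak{g}=(\langle\!\langle\mathfrak{f},\mathfrak{g}\rangle\!\rangle,F::G)$. - $\mathbf{A}\multimap\mathbf{B}$ is the set of projects $\mathfrak{f}$ such that for all $\mathfrak{a}\in\mathbf{A}$, $\mathfrak{f}::\mathfrak{a}$ is defined and in $\mathbf{B}$. Success. - $\hat G$ is the simple graph on $V_G$ with one edge $(v,w)$ whenever $E_G(v,w)\neq\emptyset$, of weight $\sum_{e\in E_G(v,w)}\omega(e)$. - $G^k$ is the graph on $V_G$ whose edges are the paths of $k$ edges in $G$. - $G$ is symmetric if for all $v,w$ there is a weight-preserving bijection $E_G(v,w)\to E_G(w,v)$. - $\mathrm{Tr}(G)=\sum_v\sum_{e\in E_G(v,v)}\omega(e)$. - A project $(a,A)$ is successful if $a=0$, $\hat A$ is symmetric, $(\hat A)^3=\hat A$, and $\mathrm{Tr}(A)=0$. *)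

(* Defs.v *)
From HB Require Import structures.
From mathcomp Require Import all_boot all_order all_algebra finmap.
From mathcomp Require Import all_classical all_reals all_analysis.

Set Implicit Arguments.
Unset Strict Implicit.
Unset Printing Implicit Defensive.

Import Order.TTheory GRing.Theory Num.Theory.

Local Open Scope classical_set_scope.
Local Open Scope fset_scope.
Local Open Scope ereal_scope.
Local Open Scope ring_scope.

(* Vertices are taken in an ambient type [U], so that carriers can be united,
   intersected and compared.  The weights are in an arbitrary type [W] because
   [hat] below produces weights outside (0,1]. *)
Record wgraph (U : choiceType) (W : Type) := WGraph {
  vertices : {fset U};
  edges : countType;
  src : edges -> U;
  tgt : edges -> U;
  wgt : edges -> W;
  src_in : forall e, src e \in vertices;
  tgt_in : forall e, tgt e \in vertices }.

Arguments src {U W} _ _.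
Arguments tgt {U W} _ _.
Arguments wgt {U W} _ _.

Section WGraphTheory.
Context {U : choiceType} {W : Type}.
Implicit Types G H : wgraph U W.

Definition between G (v w : U) : set (edges G) :=
  [set e | src G e = v /\ tgt G e = w].
Arguments between : clear implicits.

(* [walk G v p w]: the edges of [p] are consecutive and lead from [v] to [w].
   The endpoints are explicit so that the empty path is allowed. *)
Fixpoint walk G (v : U) (p : seq (edges G)) (w : U) : bool :=
  if p is e :: q then (src G e == v) && walk (tgt G e) q w else v == w.

Definition is_cycle G (c : seq (edges G)) : bool :=
  (c != [::]) && cycle (fun e f => tgt G e == src G f) c.

Definition seq_pow (T : Type) (p : seq T) (k : nat) : seq T :=
  flatten (nseq k p).

Definition is_1cycle G (c : seq (edges G)) : Prop :=
  is_cycle c /\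
  forall (r : seq (edges G)) (k : nat), is_cycle r -> (2 <= k)%N ->
    c <> seq_pow r k.

Definition symmetric_graph G : Prop :=
  {in vertices G &, forall v w, exists2 phi : edges G -> edges G,
    set_bij (between G v w) (between G w v) phi &
    forall e, between G v w e -> wgt G (phi e) = wgt G e}.

(* Equality of graphs: same vertices, same edges up to renaming.  Parallel
   edges are not merged, so this is finer than equality of the matrices of
   total weights. *)
Definition same_graph G H : Prop :=
  vertices G = vertices H /\
  exists2 phi : edges G -> edges H, bijective phi &
    forall e, [/\ src H (phi e) = src G e,
                  tgt H (phi e) = tgt G e & wgt H (phi e) = wgt G e].

(* The graph on [V] whose edges are the paths of [G] between vertices of [V]
   satisfying [P], with weights given by [wt]. *)
Definition path_graph W' G (V : {fset U}) (P : pred (seq (edges G)))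
    (wt : seq (edges G) -> W') : wgraph U W' :=
  @WGraph U W' V
    {x : V * seq (edges G) * V |
      walk (val x.1.1) x.1.2 (val x.2) && P x.1.2}
    (fun x => val (val x).1.1)
    (fun x => val (val x).2)
    (fun x => wt (val x).1.2)
    (fun x => valP (val x).1.1)
    (fun x => valP (val x).2).

End WGraphTheory.

Arguments between {U W} _ _ _ _.

Record graph (U : choiceType) (R : realType) := Graph {
  graph_base :> wgraph U R;
  wgt_gt0 : forall e : edges graph_base, 0 < wgt graph_base e;
  wgt_le1 : forall e : edges graph_base, wgt graph_base e <= 1 }.

Section Graphs.
Context {U : choiceType} {R : realType}.
Implicit Types F G H : graph U R.

Definition path_wgt (G : wgraph U R) (p : seq (edges G)) : R :=
  \prod_(e <- p) wgt G e.

Lemma path_wgt_gt0 G (p : seq (edges G)) : 0 < path_wgt p.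
Proof. by apply: prodr_gt0 => e _; apply: wgt_gt0. Qed.

Lemma path_wgt_le1 G (p : seq (edges G)) : path_wgt p <= 1.
Proof.
by apply: prodr_ile1 => e _; rewrite wgt_le1 ltW ?wgt_gt0.
Qed.

Section Union.
Variables F G : graph U R.

Definition union_src (e : edges F + edges G) : U :=
  match e with inl f => src F f | inr g => src G g end.
Definition union_tgt (e : edges F + edges G) : U :=
  match e with inl f => tgt F f | inr g => tgt G g end.
Definition union_wgt (e : edges F + edges G) : R :=
  match e with inl f => wgt F f | inr g => wgt G g end.

Lemma union_src_in e : union_src e \in (vertices F `|` vertices G)%fset.
Proof. by case: e => e /=; rewrite inE src_in ?orbT. Qed.

Lemma union_tgt_in e : union_tgt e \in (vertices F `|` vertices G)%fset.
Proof. by case: e => e /=; rewrite inE tgt_in ?orbT. Qed.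

Definition union_base : wgraph U R :=
  @WGraph U R (vertices F `|` vertices G)%fset (edges F + edges G)%type
    union_src union_tgt union_wgt union_src_in union_tgt_in.

Lemma union_wgt_gt0 (e : edges union_base) : 0 < wgt union_base e.
Proof. by case: e => e; apply: wgt_gt0. Qed.

Lemma union_wgt_le1 (e : edges union_base) : wgt union_base e <= 1.
Proof. by case: e => e; apply: wgt_le1. Qed.

Definition gunion : graph U R := Graph union_wgt_gt0 union_wgt_le1.

(* An edge of the union is coloured by [is_inl]. *)
Definition bicoloured (e f : edges gunion) : bool :=
  is_inl (e : edges F + edges G) != is_inl (f : edges F + edges G).

Definition alternating_path (p : seq (edges gunion)) : bool := sorted bicoloured p.

(* [path.cycle] also compares the last edge with the first one. *)
Definition alternating_cycle (c : seq (edges gunion)) : bool :=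
  is_cycle c && cycle bicoloured c.

(* A circuit is the set of all the rotations of a 1-cycle. *)
Definition Cycl : set (set (seq (edges gunion))) :=
  [set C | exists c : seq (edges gunion),
    [/\ is_1cycle c, alternating_cycle c & C = [set rot n c | n in [set: nat]]]].

(* The weight does not depend on the representative. *)
Definition circuit_wgt (C : set (seq (edges gunion))) : R :=
  path_wgt (xget [::] C).

Definition meas : \bar R :=
  (\esum_(C in Cycl) - lne (1 - circuit_wgt C)%:E)%E.

Lemma meas_ge0 : (0 <= meas)%E.
Proof.
apply: esum_ge0 => C _; rewrite oppe_ge0 lne_le0 lee_fin.
by rewrite gerBl ltW// path_wgt_gt0.
Qed.

Definition fset_symdiff (A B : {fset U}) : {fset U} :=
  ((A `\` B) `|` (B `\` A))%fset.

Definition exec_base : wgraph U R :=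
  path_graph (fset_symdiff (vertices F) (vertices G))
    (fun p : seq (edges gunion) => (p != [::]) && alternating_path p)
    (@path_wgt gunion).

Lemma exec_wgt_gt0 (e : edges exec_base) : 0 < wgt exec_base e.
Proof. exact: path_wgt_gt0. Qed.

Lemma exec_wgt_le1 (e : edges exec_base) : wgt exec_base e <= 1.
Proof. exact: path_wgt_le1. Qed.

Definition gexec : graph U R := Graph exec_wgt_gt0 exec_wgt_le1.

End Union.

(* The total weights may exceed 1 or be infinite, hence weights in [\bar R]. *)
Definition hat G : wgraph U (\bar R) :=
  @WGraph U (\bar R) (vertices G)
    {x : vertices G * vertices G | `[< between G (val x.1) (val x.2) !=set0 >]}
    (fun x => val (val x).1)
    (fun x => val (val x).2)
    (fun x => \esum_(e in between G (val (val x).1) (val (val x).2))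
                (wgt G e)%:E)
    (fun x => valP (val x).1)
    (fun x => valP (val x).2).

Definition gpow (G : wgraph U (\bar R)) (k : nat) : wgraph U (\bar R) :=
  path_graph (vertices G) (fun p => size p == k)
    (fun p => (\prod_(e <- p) wgt G e)%E).

Definition graph_trace G : \bar R :=
  (\sum_(v <- vertices G) \esum_(e in between G v v) (wgt G e)%:E)%E.

End Graphs.

Record project (U : choiceType) (R : realType) := Project {
  wager : R;
  wager_ge0 : 0 <= wager;
  pgraph : graph U R }.

Section Projects.
Context {U : choiceType} {R : realType}.
Implicit Types f g a b : project U R.

(* [set (project U R)] would be a universe inconsistency, as [project U R]
   quantifies over the type of edges. *)
Definition projects : Type := project U R -> Prop.
Implicit Types S A B : projects.

Definition carrier a : {fset U} := vertices (pgraph a).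

Definition pmeas a b : \bar R :=
  ((wager a)%:E + (wager b)%:E + meas (pgraph a) (pgraph b))%E.

Lemma pmeas_ge0 a b : (0 <= pmeas a b)%E.
Proof. by rewrite !adde_ge0 ?meas_ge0// lee_fin wager_ge0. Qed.

Definition orthogonal a b : Prop :=
  [/\ carrier a = carrier b, pmeas a b <> 0%E & pmeas a b <> +oo%E].

Definition orth S : projects :=
  fun a => forall b, S b -> orthogonal a b.

Definition conduct (V : {fset U}) A : Prop :=
  [/\ exists a, A a,
      forall a, A a -> carrier a = V &
      forall a, A a <-> orth (orth A) a].

(* The composition is partial: it takes a proof that the measurement is
   finite. *)
Definition pexec f g (_ : pmeas f g <> +oo%E) : project U R :=
  Project (fine_ge0 (pmeas_ge0 f g)) (gexec (pgraph f) (pgraph g)).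

Definition lollipop A B : projects :=
  fun f => forall a, A a -> exists fa : pmeas f a <> +oo%E, B (pexec fa).

Definition successful a : Prop :=
  [/\ wager a = 0,
      symmetric_graph (hat (pgraph a)),
      same_graph (gpow (hat (pgraph a)) 3) (hat (pgraph a)) &
      graph_trace (pgraph a) = 0%E].

End Projects.

Arguments projects : clear implicits.

(* Main.v *)
Require Import Defs.
From mathcomp Require Import all_boot all_order all_algebra finmap.
From mathcomp Require Import all_classical all_reals all_analysis.
From mathcomp Require Import zify.

(* A graph underlies a successful project (of wager 0) iff its simple graph is
   a partial matching without loops whose total weights are 1 or infinite: a
   vertex with two neighbours would give two parallel paths of length 3.
   In the union of two such graphs, coloured by origin, an alternating path is
   determined, up to parallel edges, by its starting point as soon as both of its
   endpoints lie in the symmetric difference of the carriers, and its total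
   weight is a product of total weights.  Hence the execution is again a
   matching; it has no loops because a closed path would be its own reversal.
   An alternating cycle would have total weight at least 1, and, since
   -log(1 - x) = sum_j x^j/j, summing over the powers of circuits shows that the
   measurement dominates a harmonic series.  As the measurement is finite there
   is no alternating cycle, and the measurement, i.e. the wager, is 0. *)

Set Implicit Arguments.
Unset Strict Implicit.
Unset Printing Implicit Defensive.

Import Order.TTheory GRing.Theory Num.Theory.
Import numFieldNormedType.Exports.

Local Open Scope classical_set_scope.
Local Open Scope ereal_scope.
Local Open Scope ring_scope.

(** * Sums of nonnegative extended reals over arbitrary index sets *)

Section EsumExtra.
Context {R : realType}.
Local Open Scope ereal_scope.

Lemma esum_ge_term (T : choiceType) (D : set T) (a : T -> \bar R) i :
  D i -> 0 <= a i -> a i <= \esum_(j in D) a j.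
Proof.
move=> Di ai0; apply: esum_ge; exists [set i].
  by split; [exact: finite_set1 | move=> j ->].
by rewrite fsbig_set1.
Qed.

(** Reindexing along [x] turns the left sum into one over a subset of [E]; nonnegativity of [b]
    accounts for the indices outside the image. *)
Lemma esum_le_inj (T T' : choiceType) (D : set T) (E : set T')
    (a : T -> \bar R) (b : T' -> \bar R) (x : T -> T') :
  (forall i, E i -> 0 <= b i) -> (forall i, D i -> E (x i)) ->
  set_inj D x -> (forall i, D i -> a i <= b (x i)) ->
  \esum_(i in D) a i <= \esum_(j in E) b j.
Proof.
move=> b0 DE xinj ab; apply: (le_trans (le_esum ab)).
rewrite -esum_image// esum_mkcond [leRHS]esum_mkcond.
apply: le_esum => j _; case: ifPn => [|_].
  by rewrite inE => -[i Di <-]; rewrite ifT// inE; exact: DE.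
by case: ifPn => //; rewrite inE => /b0.
Qed.

Lemma esumZl (T : choiceType) (D : set T) (a : T -> \bar R) (c : \bar R) :
  0 <= c -> (forall i, D i -> 0 <= a i) ->
  \esum_(i in D) (c * a i) = c * \esum_(i in D) a i.
Proof.
move=> c0 a0; case: c c0 => [r|_|//].
  rewrite lee_fin => r0; rewrite /esum -ereal_supZl//; last first.
    by apply/set0P; exists 0; exists set0; [exact: fsets_set0 | rewrite fsbig_set0].
  congr ereal_sup; rewrite image_comp; apply: eq_imagel => X [finX XD] /=.
  rewrite !fsbig_finite//= big_seq [in RHS]big_seq.
  rewrite ge0_sume_distrr// => i.
  by rewrite in_fset_set// inE => /XD/a0.
(* For [c = +oo]: if all terms vanish, both sides are 0 by the convention [+oo * 0 = 0]; otherwise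
   one positive term makes both infinite. *)
have [aD0|] := pselect (forall i, D i -> a i = 0).
  by rewrite (esum1 aD0) mule0 esum1// => i /aD0 ->; rewrite mule0.
move=> /existsNP[i] /not_implyP[Di ai0].
have aip : 0 < a i by rewrite lt_neqAle a0// eq_sym andbT; apply/eqP.
rewrite [RHS]gt0_mulye; last by exact: lt_le_trans (esum_ge_term Di (a0 i Di)).
apply/eqP; rewrite -leye_eq -[leLHS](gt0_mulye aip).
by apply: (@esum_ge_term _ _ (fun j => +oo * a j)) => //; rewrite gt0_mulye.
Qed.

(** Distributivity: the letters of a word with prescribed keys are chosen independently. This gives
    the total weight of a family of parallel paths. *)
Lemma esum_words (T : choiceType) (K : eqType) (key : T -> K)
    (a : T -> \bar R) (s : seq K) :
  (forall e, 0 <= a e) ->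
  \esum_(w in [set w | map key w = s]) \prod_(e <- w) a e =
  \prod_(k <- s) \esum_(e in [set e | key e = k]) a e.
Proof.
move=> a0; elim: s => [|k s IH].
  rewrite big_nil (_ : [set w | _] = [set [::]]) ?esum_set1 ?big_nil ?lee01//.
  by apply/seteqP; split=> [[]|_ ->].
rewrite big_cons -IH.
rewrite (reindex_esum ([set e | key e = k] `*` [set w | map key w = s]) _
  (fun x => x.1 :: x.2)).
  rewrite (eq_esum (b := fun x => a x.1 * \prod_(e <- x.2) a e)); last first.
    by move=> x _; rewrite big_cons.
  have p0 w : 0 <= \prod_(e <- w) a e.
    by elim: w => [|e w IHw]; rewrite ?big_nil ?lee01// big_cons mule_ge0.
  rewrite -(@esum_esum _ _ _ _ (fun=> [set w | map key w = s])
     (fun e w => a e * \prod_(e <- w) a e)); last by move=> *; rewrite mule_ge0.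
  rewrite (eq_esum (fun e _ => esumZl (a0 e) (fun w _ => p0 w))).
  under eq_esum do rewrite muleC.
  by rewrite esumZl 1?muleC//; apply: esum_ge0.
split=> [[e w] /= [-> ->]//|[e w] [e' w'] /= _ _ [-> ->]//|].
by move=> [//|e w] /= [<- <-]; exists (e, w).
Qed.

Lemma esum_harmonic (n : nat) : (0 < n)%N ->
  \esum_(k in [set: nat]) ((k.+1 * n)%:R^-1)%:E = +oo :> \bar R.
Proof.
move=> n0.
under eq_esum do rewrite natrM invfM mulrC EFinM.
rewrite esumZl; last 2 first.
- by rewrite lee_fin invr_ge0.
- by move=> i _; rewrite lee_fin invr_ge0.
rewrite -nneseries_esumT; last by move=> i; rewrite lee_fin invr_ge0.
suff -> : \sum_(i <oo) (i.+1%:R^-1)%:E = +oo :> \bar R.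
  by rewrite gt0_muley// lte_fin invr_gt0 ltr0n.
have nd : nondecreasing_seq (series (@harmonic R)).
  by apply: nondecreasing_series => i _ _; exact: harmonic_ge0.
have := nondecreasing_dvgn_lt nd (@dvg_harmonic R).
move=> /cvgeryP /cvg_lim <-//; congr (limn _); apply/funext => m /=.
by rewrite /series/= sumEFin.
Qed.
End EsumExtra.

(** * The power series of -ln(1 - x) *)

Lemma sum_expr_le_Nln (R : realType) (x : R) (n : nat) : 0 <= x < 1 ->
  \sum_(0 <= k < n) (x ^+ k.+1 / k.+1%:R) <= - ln (1 - x).
Proof.
move=> /andP[x0 x1].
(* [h] vanishes at 0, and its derivative, 1/(1 - y) minus a geometric sum, equals y^n/(1 - y), which
   is nonnegative between 0 and [x]. Hence [h x] is nonnegative. *)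
pose h (y : R) := - ln (1 - y) - \sum_(0 <= k < n) (y ^+ k.+1 / k.+1%:R).
have dh (y : R) : y < 1 ->
    is_derive y 1 h ((1 - y)^-1 - \sum_(0 <= k < n) y ^+ k).
  move=> y1.
  have y1' : 0 < 1 - y by rewrite subr_gt0.
  apply: is_deriveB; last first.
    elim: n {h} => [|n IHn].
      rewrite big_nil (_ : (fun _ => _) = cst 0); first exact: is_derive_cst.
      by apply/funext => z; rewrite big_nil.
    rewrite big_nat_recr//= (_ : (fun z => _) =
      (fun z => \sum_(0 <= k < n) (z ^+ k.+1 / k.+1%:R)) +
      (n.+1%:R^-1 \*: (id ^+ n.+1 : R -> R))); last first.
      by apply/funext => z; rewrite big_nat_recr//= !fctE/= [X in _ + X]mulrC.
    apply: is_deriveD.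
    have -> : y ^+ n = n.+1%:R^-1 *: ((n.+1%:R * (id y) ^+ n.+1.-1) *: (1 : R)).
      by rewrite /= /GRing.scale/= mulr1 mulKf// pnatr_eq0.
    exact: is_deriveZ.
  rewrite -[X in is_derive _ _ _ X]opprK.
  apply: is_deriveN.
  rewrite -[X in is_derive _ _ _ X]mulrN1.
  have dB : is_derive y 1 (fun z : R => 1 - z) (-1).
    rewrite -[X in is_derive _ _ _ X]add0r.
    exact: (is_deriveB (is_derive_cst _ _ _)).
  exact: (@is_derive1_comp _ _ (fun z => 1 - z) _ _ _ (is_derive1_ln y1') dB).
have x01 (z : R) : z \in `[0, x] -> z < 1.
  by rewrite in_itv/= => /andP[_ /le_lt_trans]; apply.
have := @ger0_derive1_le_cc R h 0 x _ _ _ 0 x.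
rewrite !bound_itvE x0 => /(_ _ _ _ isT isT isT).
rewrite /h subr0 ln1 oppr0 sub0r big1 ?oppr0 ?subr_ge0; last first.
  by move=> k _; rewrite expr0n/= mul0r.
apply.
- by move=> z /subset_itv_oo_cc/x01/dh[].
- move=> z zx; have z1 := x01 z (subset_itv_oo_cc zx).
  rewrite derive1E (@derive_val _ _ _ _ _ _ _ (dh z z1)).
  have z1' : 0 < 1 - z by rewrite subr_gt0.
  rewrite subr_ge0 -[leRHS]mul1r ler_pdivlMr// mulrC big_mkord -opprB mulNr -subrX1 opprB.
  by rewrite gerBl exprn_ge0//; move: zx; rewrite in_itv/= => /andP[/ltW].
- by apply: derivable_within_continuous => z /x01/dh[].
Qed.

Lemma esum_expr_le_Nlne (R : realType) (x : R) : 0 <= x <= 1 ->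
  (\esum_(k in [set: nat]) (x ^+ k.+1 / k.+1%:R)%:E <= - lne (1 - x)%:E)%E.
Proof.
move=> /andP[x0]; rewrite le_eqVlt => /predU1P[->|x1].
  (* At [x = 1] the right-hand side is -log 0, which is infinite. *)
  by rewrite subrr le0_lneNy// leey.
have p0 k : (0 <= (x ^+ k.+1 / k.+1%:R)%:E)%E.
  by rewrite lee_fin divr_ge0// exprn_ge0.
rewrite -nneseries_esumT//; apply: lime_le; first exact: is_cvg_nneseries.
apply: nearW => n; rewrite sumEFin lne_EFin ?subr_gt0// -EFinN lee_fin.
by apply: sum_expr_le_Nln; rewrite x0.
Qed.

(** * Powers and rotations of sequences *)

Section SeqPow.
Variable T : Type.
Implicit Types (p : seq T) (r : rel T).

Lemma seq_powS p k : seq_pow p k.+1 = p ++ seq_pow p k. Proof. by []. Qed.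

Lemma seq_powD p j k : seq_pow p (j + k) = seq_pow p j ++ seq_pow p k.
Proof. by elim: j => //= j IHj; rewrite addSn !seq_powS IHj catA. Qed.

Lemma seq_powM p j k : seq_pow (seq_pow p j) k = seq_pow p (k * j).
Proof. by elim: k => //= k IHk; rewrite mulSn seq_powD seq_powS IHk. Qed.

Lemma size_seq_pow p k : size (seq_pow p k) = (k * size p)%N.
Proof. by elim: k => //= k IHk; rewrite seq_powS size_cat IHk mulSn. Qed.

(** Each junction of two copies of [p] repeats the comparison that closes the cycle [p]. The
    exponent is positive because the empty sequence is vacuously a cycle. *)
Lemma cycle_seq_pow r p k : cycle r (seq_pow p k.+1) = cycle r p.
Proof.
case: p => [|x p]; first by elim: k.
rewrite seq_powS /=; elim: k => [|k IHk]; first by rewrite cats0.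
rewrite seq_powS /= rcons_cat cat_path /= IHk.
by rewrite rcons_path; case: path => //=; rewrite andbb.
Qed.

Lemma big_seq_pow (R : Type) (idx : R) (op : Monoid.law idx) (f : T -> R) p k :
  \big[op/idx]_(e <- seq_pow p k) f e =
  iterop k op (\big[op/idx]_(e <- p) f e) idx.
Proof.
elim: k => [|k IHk]; first by rewrite big_nil.
rewrite seq_powS big_cat /= IHk; case: k {IHk} => [|k] //=.
by rewrite Monoid.mulm1.
Qed.

Lemma rot_lt_size n p : p <> [::] -> exists2 m, (m < size p)%N & rot n p = rot m p.
Proof.
move=> p0; have [np|pn] := ltnP n (size p); first by exists n.
by exists 0%N; [case: p p0 {pn} | rewrite rot0 rot_oversize].
Qed.

Lemma rot_inv n p : p <> [::] ->
  exists2 m, (m < size p)%N & p = rot m (rot n p).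
Proof.
move=> p0; have pn0 : rot n p <> [::].
  by move=> /(congr1 size); rewrite size_rot; case: p p0.
have [m] := rot_lt_size (size (rot n p) - n) pn0; rewrite size_rot => mp e.
by exists m => //; rewrite -e -{1}(rotK n p) /rotr size_rot.
Qed.

End SeqPow.

(** * Alternating cycles as powers of circuits *)

Section Circuits.
Context {U : choiceType} {R : realType} (F G : graph U R).
Local Notation T := (edges (gunion F G)).
Implicit Types (c w : seq T).

Lemma path_wgt_pow c k : path_wgt (seq_pow c k) = path_wgt c ^+ k.
Proof. by rewrite /path_wgt big_seq_pow. Qed.

Lemma path_wgt_rot n c : path_wgt (rot n c) = path_wgt c.
Proof. by apply: perm_big; rewrite perm_rot. Qed.

Lemma alternating_cycle_pow c k :
  alternating_cycle (seq_pow c k.+1) = alternating_cycle c.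
Proof.
rewrite /alternating_cycle /is_cycle !cycle_seq_pow; congr (_ && _ && _).
by rewrite -!size_eq0 size_seq_pow muln_eq0.
Qed.

(** Strong induction on the length: a cycle that is not a 1-cycle is a proper power of a strictly
    shorter cycle, which is still alternating. *)
Lemma alternating_cycle_root w : alternating_cycle w ->
  exists c j, [/\ is_1cycle c, alternating_cycle c & w = seq_pow c j.+1].
Proof.
have [n] := ubnP (size w); elim: n w => // n IHn w wn aw.
have [w1|] := pselect (is_1cycle w); first by exists w, 0%N; rewrite /seq_pow/= cats0.
move=> /not_andP[|]; first by move: aw => /andP[-> _].
move=> /existsNP[r] /existsNP[k] /not_implyP[rc] /not_implyP[].
case: k => [//|k] k1 /contrapT wr.
have ar : alternating_cycle r by rewrite -(alternating_cycle_pow r k) -wr.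
have rn : (size r < n)%N.
  have r0 : (0 < size r)%N by rewrite lt0n size_eq0; case/andP: rc.
  rewrite -ltnS; apply: leq_ltn_trans wn; rewrite wr size_seq_pow.
  by rewrite -[ltnLHS]mul1n ltn_pmul2r.
have [c [j [c1 ac rE]]] := IHn r rn ar.
by exists c, (k.+1 * j.+1).-1; split => //; rewrite wr rE seq_powM.
Qed.

(** [circuit_wgt] is computed on the representative picked by [xget], so the root of [w] is
    rewritten as a rotation of that representative. The triple encodes the circuit, the exponent
    minus one and the rotation index. *)
Lemma alternating_cycle_circuit w : alternating_cycle w ->
  exists x : set (seq T) * (nat * nat),
    [/\ Cycl x.1, (x.2.2 < size (xget [::] x.1))%N &
    w = seq_pow (rot x.2.2 (xget [::] x.1)) x.2.1.+1].
Proof.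
move=> /alternating_cycle_root[c [j [c1 ac ->]]].
pose C := [set rot n c | n in [set: nat]].
have c0 : c <> [::] by move=> c0; rewrite c0 in ac.
have [n _ nE] : C (xget [::] C) by apply: (@xgetI _ _ _ c); exists 0%N; rewrite ?rot0.
have [m mc cE] := rot_inv n c0.
exists (C, (j, m)); split => /=.
- by exists c.
- by rewrite -nE size_rot.
- by rewrite -nE -cE.
Qed.

(* Sending an alternating cycle (a j-th power of a rotation of the representative
   c of a circuit) to (circuit, j, rotation index) is injective, and each of the
   |c| rotations has weight x^j/(j |c|), where x is the weight of the circuit. *)
Lemma esum_alternating_cycles_le_meas :
  (\esum_(w in [set w : seq T | alternating_cycle w])
     (path_wgt w / (size w)%:R)%:E <= meas F G)%E.
Proof.
(* The hypothesis is kept inside [P] so that the encoding can be chosen on all sequences, with a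
   dummy value off the alternating cycles. *)
pose P w (x : set (seq T) * (nat * nat)) := alternating_cycle w ->
  [/\ Cycl x.1, (x.2.2 < size (xget [::] x.1))%N &
   w = seq_pow (rot x.2.2 (xget [::] x.1)) x.2.1.+1].
have [x xP] : {x : seq T -> set (seq T) * (nat * nat) & forall w, P w (x w)}.
  suff exP w : exists y, P w y by exact: choice exP.
  have [/alternating_cycle_circuit[y yP]|nw] := boolP (alternating_cycle w).
    by exists y.
  by exists (set0, (0%N, 0%N)) => aw; rewrite aw in nw.
rewrite /P in xP.
pose b (C : set (seq T)) (y : nat * nat) : \bar R :=
  (circuit_wgt C ^+ y.1.+1 / y.1.+1%:R / (size (xget [::] C))%:R)%:E.
have w0 (C : set (seq T)) : (0 <= circuit_wgt C)%R by exact/ltW/path_wgt_gt0.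
have b0 C y : (0 <= b C y)%E by rewrite lee_fin !divr_ge0// exprn_ge0.
apply: (@le_trans _ _ (\esum_(C in @Cycl U R F G)
    \esum_(y in [set: nat] `*` `I_(size (xget [::] C))) b C y)%E).
  rewrite (@esum_esum _ _ _ _ (fun C => [set: nat] `*` `I_(size (xget [::] C))))//.
  apply: (esum_le_inj (x := x)).
  - by move=> *; exact: b0.
  - by move=> w /xP[? ? _]; split.
  - move=> w w'; rewrite !inE => /xP[_ _ wE] /xP[_ _ w'E] e.
    by rewrite wE w'E e.
  - move=> w /xP[_ _ wE]; rewrite {1 2}wE /b lee_fin path_wgt_pow path_wgt_rot.
    by rewrite size_seq_pow size_rot natrM invfM mulrA.
apply: le_esum => C /= CC.
have sC : (0 < size (xget [::] C))%N.
  case: CC => c [c1 ac CE].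
  have : C (xget [::] C).
    by apply: (@xgetI _ _ _ c); rewrite CE; exists 0%N; rewrite ?rot0.
  rewrite {1}CE => -[n _ <-].
  by rewrite size_rot lt0n size_eq0; case/andP: ac => /andP[].
rewrite -(@esum_esum _ _ _ _ (fun=> `I_(size (xget [::] C))) (fun j n => b C (j, n)))//.
(* For each exponent the equal shares of the rotations add up to x^j/j, leaving the logarithmic
   series of the circuit. *)
apply: le_trans (esum_expr_le_Nlne _).
  apply: le_esum => j _; rewrite esum_fset// -fsbig_ord/=.
  rewrite sumEFin lee_fin /= sumr_const card_ord -[leLHS]mulr_natr divfK//.
  by rewrite pnatr_eq0 -lt0n.
by rewrite w0 path_wgt_le1.
Qed.

End Circuits.

(** * Paths up to parallel edges *)

Section Keys.
Context {U : choiceType} {R : realType} (F G : graph U R).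
Local Notation T := (edges (gunion F G)).
Implicit Types (e f : T) (p w c : seq T).

(** Edges with the same key are parallel and of the same colour. Being a walk, alternating or a
    cycle depends on keys alone, so weights can be summed over all sequences with given keys. *)
Definition edge_key e : bool * U * U :=
  (is_inl (e : edges F + edges G), src (gunion F G) e, tgt (gunion F G) e).

Definition key_wgt (k : bool * U * U) : \bar R :=
  (\esum_(e in [set e | edge_key e = k]) (wgt (gunion F G) e)%:E)%E.

Lemma esum_path_wgt (s : seq (bool * U * U)) :
  (\esum_(w in [set w | map edge_key w = s]) (path_wgt w)%:E =
   \prod_(k <- s) key_wgt k)%E.
Proof.
rewrite -esum_words; last by move=> e; rewrite lee_fin ltW ?wgt_gt0.
apply: eq_esum => w _; rewrite /path_wgt.
by elim/big_rec2: _ => // e x y _ <-; rewrite EFinM.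
Qed.

Lemma edge_key_alternating_cycle w c : map edge_key w = map edge_key c ->
  alternating_cycle w = alternating_cycle c.
Proof.
move=> wc; rewrite /alternating_cycle /is_cycle.
pose r1 (k l : bool * U * U) := k.2 == l.1.2.
pose r2 (k l : bool * U * U) := k.1.1 != l.1.1.
congr (_ && _ && _).
- by rewrite -!size_eq0 -!(size_map edge_key) wc.
- by transitivity (cycle r1 (map edge_key w)); [rewrite cycle_map | rewrite wc cycle_map].
- by transitivity (cycle r2 (map edge_key w)); [rewrite cycle_map | rewrite wc cycle_map].
Qed.

Lemma edge_key_walk (v u : U) p q : map edge_key p = map edge_key q ->
  walk v p u = walk v q u.
Proof. by elim: p q v => [|e p IHp] [|f q] v //= [_ -> -> /IHp ->]. Qed.

Lemma edge_key_alternating_path p q : map edge_key p = map edge_key q ->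
  alternating_path p = alternating_path q.
Proof.
move=> pq; pose r2 (k l : bool * U * U) := k.1.1 != l.1.1.
by transitivity (sorted r2 (map edge_key p)); [rewrite sorted_map | rewrite pq sorted_map].
Qed.

Lemma prode_ge1 (I : Type) (s : seq I) (f : I -> \bar R) :
  (forall i, (1 <= f i)%E) -> (1 <= \prod_(i <- s) f i)%E.
Proof.
move=> f1; elim: s => [|i s IHs]; first by rewrite big_nil.
rewrite big_cons -[leLHS]mule1; apply: lee_pmul => //.
Qed.

(* The cycles parallel to the k-th power of c have total weight at least 1 and
   contribute at least 1/(k |c|). *)
Lemma meas_pinfty c : alternating_cycle c ->
  (forall e, (1 <= key_wgt (edge_key e))%E) -> meas F G = +oo%E.
Proof.
move=> ac k1; apply/eqP; rewrite -leye_eq.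
apply: le_trans (esum_alternating_cycles_le_meas F G).
have c0 : (0 < size c)%N by rewrite lt0n size_eq0; case/andP: ac => /andP[].
pose W k := [set w | map edge_key w = map edge_key (seq_pow c k.+1)].
have sW k w : W k w -> size w = (k.+1 * size c)%N.
  by rewrite /W/= -(size_map edge_key w) => ->; rewrite size_map size_seq_pow.
have b0 w : (0 <= (path_wgt w / (size w)%:R)%:E)%E.
  by rewrite lee_fin divr_ge0// ltW ?path_wgt_gt0.
apply: (@le_trans _ _ (\esum_(k in [set: nat]) \esum_(w in W k)
  (path_wgt w / (size w)%:R)%:E)%E); last first.
  rewrite (@esum_esum _ _ _ _ W (fun k w => (path_wgt w / (size w)%:R)%:E))//.
  apply: (esum_le_inj (x := snd)) => //.
  - move=> [k w] [_] /= Ww.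
    by rewrite (edge_key_alternating_cycle Ww) alternating_cycle_pow.
  (* The length of [w] determines [k], so the families [W k] are pairwise disjoint and forgetting
     [k] is injective. *)
  - move=> [k w] [k' w']; rewrite !inE => -[_ /= /sW s] [_ /= /sW s'] e.
    rewrite -e; congr (_, _); move: s; rewrite e s' => /eqP.
    by rewrite eqn_pmul2r// eqSS eq_sym => /eqP.
rewrite -(esum_harmonic c0); apply: le_esum => k _.
rewrite (eq_esum (b := fun w => ((k.+1 * size c)%:R^-1)%:E * (path_wgt w)%:E)%E).
  rewrite esumZl ?lee_fin ?invr_ge0//; last first.
    by move=> w _; rewrite lee_fin ltW ?path_wgt_gt0.
  rewrite esum_path_wgt -[leLHS]mule1; apply: lee_wpmul2l.
    by rewrite lee_fin invr_ge0.
  by rewrite big_map; apply: prode_ge1.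
by move=> w /sW ->; rewrite mulrC EFinM.
Qed.

End Keys.

(** * Successful projects and matchings *)

Section Matching.
Context {U : choiceType} {R : realType}.
Implicit Types G H : graph U R.

Definition total_wgt G (v w : U) : \bar R :=
  (\esum_(e in between G v w) (wgt G e)%:E)%E.

(* An infinite total weight satisfies x^3 = x in the extended reals. *)
Record matching G : Prop := Matching {
  matching_tgt : forall e f, src G e = src G f -> tgt G e = tgt G f;
  matching_rev : forall e, exists f, [/\ src G f = tgt G e, tgt G f = src G e &
    total_wgt G (src G f) (tgt G f) = total_wgt G (src G e) (tgt G e)];
  matching_wgt : forall e, total_wgt G (src G e) (tgt G e) = 1%E \/
    total_wgt G (src G e) (tgt G e) = +oo%E;
  matching_loop : forall e, src G e <> tgt G e }.

Lemma total_wgt_gt0 G e : (0 < total_wgt G (src G e) (tgt G e))%E.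
Proof.
apply: (@lt_le_trans _ _ (wgt G e)%:E); first by rewrite lte_fin wgt_gt0.
apply: (@esum_ge_term _ _ _ (fun f => (wgt G f)%:E)) => //.
by rewrite lee_fin ltW ?wgt_gt0.
Qed.

Lemma hat_edge G e : exists h,
  src (hat G) h = src G e /\ tgt (hat G) h = tgt G e.
Proof.
have eP : `[< between G (val ([` src_in e]%fset, [` tgt_in e]%fset).1)
    (val ([` src_in e]%fset, [` tgt_in e]%fset).2) !=set0 >].
  by apply/asboolP; exists e.
by exists (exist _ ([` src_in e]%fset, [` tgt_in e]%fset) eP).
Qed.

Lemma hat_between G h : exists e,
  src G e = src (hat G) h /\ tgt G e = tgt (hat G) h.
Proof. by have /asboolP[e [se te]] := valP h; exists e. Qed.

Lemma hat_simple G h h' : src (hat G) h = src (hat G) h' ->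
  tgt (hat G) h = tgt (hat G) h' -> h = h'.
Proof.
move=> s t; apply: val_inj; case: h s t => -[x y] hP; case: h' => -[x' y'] hP' /=.
by move=> /val_inj -> /val_inj ->.
Qed.

Lemma hat_wgt G h : wgt (hat G) h = total_wgt G (src (hat G) h) (tgt (hat G) h).
Proof. by []. Qed.

Lemma gpow_edge G h k l : tgt (hat G) h = src (hat G) k ->
  tgt (hat G) k = src (hat G) l ->
  exists x : edges (gpow (hat G) 3), [/\ (val x).1.2 = [:: h; k; l],
    src (gpow (hat G) 3) x = src (hat G) h, tgt (gpow (hat G) 3) x = tgt (hat G) l &
    wgt (gpow (hat G) 3) x = (wgt (hat G) h * (wgt (hat G) k * wgt (hat G) l))%E].
Proof.
move=> hk kl.
pose y := ([` src_in h]%fset, [:: h; k; l], [` tgt_in l]%fset).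
have yP : walk (val y.1.1) y.1.2 (val y.2) && (size y.1.2 == 3).
  suff : [&& src (hat G) h == src (hat G) h, src (hat G) k == tgt (hat G) h,
      src (hat G) l == tgt (hat G) k & tgt (hat G) l == tgt (hat G) l].
    by move=> w3; apply/andP.
  by rewrite hk kl !eqxx.
exists (exist _ y yP); split => //=.
by rewrite !big_cons big_nil mule1.
Qed.

Lemma gpow_walk G (x : edges (gpow (hat G) 3)) : exists h k l,
  [/\ (val x).1.2 = [:: h; k; l], src (gpow (hat G) 3) x = src (hat G) h,
      tgt (hat G) h = src (hat G) k, tgt (hat G) k = src (hat G) l &
      tgt (gpow (hat G) 3) x = tgt (hat G) l].
Proof.
case: x => -[[v p] w] /= xP; case/andP: (xP) => /=.
move=> + /eqP; case: p xP => [//|h [//|k [//|l [|//]]]] xP /=.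
move=> /and4P[/eqP hv /eqP kh /eqP lk /eqP wl] _.
by exists h, k, l.
Qed.

Lemma successful_matching (a : project U R) : successful a -> matching (pgraph a).
Proof.
case: a => r r0 G [/= _ symG [_ [phi phibij phiP]] trG].
have phi_inj := bij_inj phibij.
have hrev h : exists h', [/\ src (hat G) h' = tgt (hat G) h,
    tgt (hat G) h' = src (hat G) h & wgt (hat G) h' = wgt (hat G) h].
  have [psi [psiF _ _] psiW] := symG _ _ (src_in h) (tgt_in h).
  have hB : between (hat G) (src (hat G) h) (tgt (hat G) h) h by [].
  by have [s t] := psiF _ hB; exists (psi h); split => //; exact: psiW.
(* With [k], [k'] the reverses of [h], [h'], the paths [[:: h; k; h']] and [[:: h'; k'; h']] have
   the same endpoints. Their images in the simple graph coincide, hence so do the paths and their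
   first edges. *)
have hdet h h' : src (hat G) h = src (hat G) h' -> h = h'.
  move=> hh'.
  have [k [sk tk _]] := hrev h; have [k' [sk' tk' _]] := hrev h'.
  have [x [xE sx tx _]] := gpow_edge (esym sk) (etrans tk hh').
  have [x' [x'E sx' tx' _]] := gpow_edge (esym sk') tk'.
  have [s t _] := phiP x; have [s' t' _] := phiP x'.
  have : phi x = phi x' by apply: hat_simple; rewrite ?s ?s' ?t ?t' ?sx ?sx' ?tx ?tx'.
  by move=> /phi_inj xx'; move: xE; rewrite xx' x'E => -[].
split.
- move=> e f ef; have [h [sh th]] := hat_edge e; have [h' [sh' th']] := hat_edge f.
  by rewrite -th -th' (hdet h h')// sh sh'.
- move=> e; have [h [sh th]] := hat_edge e; have [h' [sh' th' wh']] := hrev h.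
  have [f [sf tf]] := hat_between h'; exists f.
  by rewrite sf tf -hat_wgt wh' sh' th' sh th hat_wgt sh th.
- move=> e; have [h [sh th]] := hat_edge e; have [k [sk tk wk]] := hrev h.
  (* The path going along [h], back and along [h] again has image [h], so the total weight y
     satisfies y^3 = y with y positive. *)
  have [x [_ sx tx wx]] := gpow_edge (esym sk) tk.
  have [s t w] := phiP x.
  have := hat_simple (etrans s sx) (etrans t tx) => hx.
  move: w (total_wgt_gt0 e); rewrite hx wx wk hat_wgt sh th.
  case: total_wgt => [y||//]; last by right.
  move=> /(congr1 fine)/= yE; rewrite lte_fin => y0; left; congr (_%:E).
  have /eqP : y * y = 1 by apply: (mulfI (lt0r_neq0 y0)); rewrite mulr1.
  by rewrite -expr2 sqrf_eq1 => /orP[/eqP//|/eqP yN]; rewrite yN ltr0N1 in y0.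
- move=> e loop; move/eqP: trG; rewrite /graph_trace seq_psume_eq0; last first.
    by move=> v _; apply: esum_ge0 => f _; rewrite lee_fin ltW ?wgt_gt0.
  move=> /allP/(_ _ (src_in e)) /= /eqP tr0; have := total_wgt_gt0 e.
  by rewrite -loop /total_wgt tr0 ltxx.
Qed.

(** When edges are determined by their endpoints, any two endpoint-preserving choices in opposite
    directions are mutually inverse. *)
Lemma same_graph_simple (W : Type) (H K : wgraph U W) :
  vertices H = vertices K ->
  (forall e f, src H e = src H f -> tgt H e = tgt H f -> e = f) ->
  (forall e f, src K e = src K f -> tgt K e = tgt K f -> e = f) ->
  (forall e, exists f,
    [/\ src K f = src H e, tgt K f = tgt H e & wgt K f = wgt H e]) ->
  (forall f, exists e, src H e = src K f /\ tgt H e = tgt K f) ->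
  same_graph H K.
Proof.
move=> V sH sK HK KH; split => //.
have [phi phiP] := choice HK; have [psi psiP] := choice KH.
exists phi => //; exists psi => [e|f].
- by have [s t] := psiP (phi e); have [s' t' _] := phiP e; apply: sH; rewrite ?s ?t.
- by have [s t] := psiP f; have [s' t' _] := phiP (psi f); apply: sK; rewrite ?s' ?t'.
Qed.

(** Converse of [successful_matching] at the level of graphs. In a matching the only path of length
    3 starting with [h] is [h], its reverse, [h]; its weight is that of [h] because 1 and [+oo]
    equal their cubes. *)
Lemma matching_success G : matching G ->
  [/\ symmetric_graph (hat G), same_graph (gpow (hat G) 3) (hat G) &
      graph_trace G = 0%E].
Proof.
move=> [mt mr mw ml].
have hdet h h' : src (hat G) h = src (hat G) h' -> h = h'.
  move=> hh'; apply: hat_simple => //.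
  have [e [se te]] := hat_between h; have [f [sf tf]] := hat_between h'.
  by rewrite -te -tf; apply: mt; rewrite se sf.
have hrev h : exists h', [/\ src (hat G) h' = tgt (hat G) h,
    tgt (hat G) h' = src (hat G) h & wgt (hat G) h' = wgt (hat G) h].
  have [e [se te]] := hat_between h; have [f [sf tf wf]] := mr e.
  have [h' [sh' th']] := hat_edge f; exists h'.
  by rewrite !hat_wgt -se -te -wf sh' th' sf tf.
split.
- move=> v w _ _; have [[h [hv hw]]|no] := pselect (between (hat G) v w !=set0).
    have [k [sk tk wk]] := hrev h; exists (fun=> k).
      split=> [x _|x y|x [xw xv]].
      + by split; rewrite ?sk ?tk.
      + by rewrite !inE => -[xv _] [yv _] _; apply: hdet; rewrite xv yv.
      + by exists h => //; apply: hdet; rewrite sk xw.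
    by move=> x [xv xw]; rewrite wk; congr (wgt _ _); apply: hdet; rewrite hv xv.
  have no' : ~ (between (hat G) w v !=set0).
    move=> [h [hw hv]]; apply: no; have [k [sk tk _]] := hrev h.
    by exists k; split; rewrite ?sk ?tk.
  (* Without an edge in either direction both sets are empty and any map will do. *)
  exists id; last by [].
  split=> // x.
    by move=> xP; case: no; exists x.
  by move=> xP; case: no'; exists x.
- apply: same_graph_simple => //.
  + move=> x y sxy _.
    have [h [k [l [xE sh hk kl tl]]]] := gpow_walk x.
    have [h' [k' [l' [yE sh' hk' kl' tl']]]] := gpow_walk y.
    have hh' : h = h' by apply: hdet; rewrite -sh -sh'.
    have kk' : k = k' by apply: hdet; rewrite -hk -hk' hh'.
    have ll' : l = l' by apply: hdet; rewrite -kl -kl' kk'.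
    apply: val_inj; move: xE yE sh sh' tl tl'.
    case: x sxy => -[[v p] w] xP; case: y => -[[v' p'] w'] yP /= sxy.
    move=> -> -> vE v'E wE w'E; congr (_, _, _).
    * exact: val_inj.
    * by rewrite hh' kk' ll'.
    * by apply: val_inj; apply: etrans wE (etrans _ (esym w'E)); rewrite ll'.
  + exact: hat_simple.
  + move=> x; have [h [k [l [xE sh hk kl tl]]]] := gpow_walk x.
    have [k' [sk' tk' wk']] := hrev h.
    have kk' : k = k' by apply: hdet; rewrite sk'.
    have lh : l = h by apply: hdet; rewrite -kl kk'.
    exists h; split; rewrite ?tl ?lh//.
    have -> : wgt (gpow (hat G) 3) x = (\prod_(e <- (val x).1.2) wgt (hat G) e)%E by [].
    rewrite xE !big_cons big_nil mule1 lh kk' wk'.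
    rewrite hat_wgt; have [e [<- <-]] := hat_between h.
    by case: (mw e) => ->; rewrite ?mule1 ?mulyy.
  + move=> h; have [k [sk tk wk]] := hrev h.
    by have [x [_ sx tx _]] := gpow_edge (esym sk) tk; exists x.
- rewrite /graph_trace big1// => v _; apply: esum1 => e [sv tv].
  by case: (ml e); rewrite sv tv.
Qed.

End Matching.

(** * Execution and measurement of two matchings *)

Section Execution.
Context {U : choiceType} {R : realType} (F G : graph U R).
Hypotheses (mF : matching F) (mG : matching G).
Local Notation FG := (gunion F G).
Local Notation T := (edges FG).
Local Notation key := (@edge_key U R F G).
Local Notation ends := (fset_symdiff (vertices F) (vertices G)).
Implicit Types (e f : T) (p q : seq T) (u v w : U).

Lemma key_wgt_inl v w : key_wgt F G (true, v, w) = total_wgt F v w.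
Proof.
rewrite /key_wgt (reindex_esum (between F v w) _ (inl : edges F -> T))//.
split=> [e [<- <-]//|e f _ _ [->]//|].
by move=> [e|//] /= [<- <-]; exists e.
Qed.

Lemma key_wgt_inr v w : key_wgt F G (false, v, w) = total_wgt G v w.
Proof.
rewrite /key_wgt (reindex_esum (between G v w) _ (inr : edges G -> T))//.
split=> [e [<- <-]//|e f _ _ [->]//|].
by move=> [//|e] /= [<- <-]; exists e.
Qed.

Lemma key_wgt1y e : key_wgt F G (key e) = 1%E \/ key_wgt F G (key e) = +oo%E.
Proof.
by case: e => e; [rewrite key_wgt_inl; apply: matching_wgt mF e
                 |rewrite key_wgt_inr; apply: matching_wgt mG e].
Qed.

Lemma key_det e f : (key e).1 = (key f).1 -> key e = key f.
Proof.
case: e f => [e|e] [f|f] //= [ef]; rewrite /edge_key/= ef; congr (_, _).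
- exact: matching_tgt mF _ _ ef.
- exact: matching_tgt mG _ _ ef.
Qed.

Lemma key_rev e : exists f, key f = ((key e).1.1, (key e).2, (key e).1.2) /\
  key_wgt F G (key f) = key_wgt F G (key e).
Proof.
case: e => e.
- have [f [s t W]] := matching_rev mF e; exists (inl f).
  by rewrite /edge_key /= !key_wgt_inl W s t.
- have [f [s t W]] := matching_rev mG e; exists (inr f).
  by rewrite /edge_key /= !key_wgt_inr W s t.
Qed.

Lemma key_loop e : (key e).1.2 <> (key e).2.
Proof. by case: e => e /=; [apply: matching_loop mF e | apply: matching_loop mG e]. Qed.

(** A vertex of the symmetric difference lies in exactly one carrier, so all edges at it have one
    colour. *)
Lemma end_colour e u : u \in ends -> (key e).1.2 = u \/ (key e).2 = u ->
  (key e).1.1 = (u \in vertices F).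
Proof.
rewrite /fset_symdiff !inE => uE eu.
have : u \in (if (key e).1.1 then vertices F else vertices G).
  by case: e eu => e /= [] <-; rewrite ?src_in ?tgt_in.
case: (key e).1.1 => [->//|uG].
by move: uE; rewrite uG andbT /=; case: (u \in _).
Qed.

(** The conjuncts are grouped as in [exec_base], so that the proof carried by an edge of [gexec] is
    directly an [altwalk]. *)
Definition altwalk u p v := walk u p v && ((p != [::]) && alternating_path p).

(** Colour and source determine the target; the next edge starts there with the other colour. Both
    paths stop together, since an alternating path cannot pass through a vertex of [ends]
    ([stop]). *)
Lemma altwalk_key u u' e e' q q' v v' : v \in ends -> v' \in ends ->
  (key e).1 = (key e').1 -> altwalk u (e :: q) v -> altwalk u' (e' :: q') v' ->
  map key (e :: q) = map key (e' :: q').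
Proof.
move=> vE v'E.
have stop f g w : w \in ends -> (key f).2 = w -> (key g).1.2 = w ->
    bicoloured f g -> False.
  move=> wE fw gw; rewrite /bicoloured -[is_inl f]/((key f).1.1).
  rewrite -[is_inl g]/((key g).1.1).
  by rewrite (end_colour wE (or_intror fw)) (end_colour wE (or_introl gw)) eqxx.
elim: q e e' q' u u' => [|f q IHq] e e' [|f' q'] u u' ee' /= aw aw'.
- by rewrite (key_det ee').
- exfalso; have kee' := key_det ee'.
  move: aw aw' => /andP[/andP[_ /eqP ev] _] /andP[/and3P[_ /eqP ef _] /andP[_ /andP[b _]]].
  have [_ _ tt] : key e = key e' := kee'.
  exact: (stop e' f' v vE (etrans (esym tt) ev) (etrans ef (etrans (esym tt) ev)) b).
- exfalso; have kee' := key_det ee'.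
  move: aw aw' => /andP[/and3P[_ /eqP ef _] /andP[_ /andP[b _]]] /andP[/andP[_ /eqP ev] _].
  have [_ _ tt] : key e = key e' := kee'.
  exact: (stop e f v' v'E (etrans tt ev) (etrans ef (etrans tt ev)) b).
- have kee' := key_det ee'; rewrite kee'; congr (_ :: _).
  have [c _ tt] : key e = key e' := kee'.
  move: aw aw' => /andP[/and3P[_ /eqP ef wq] /andP[_ /andP[b aq]]].
  move=> /andP[/and3P[_ /eqP ef' wq'] /andP[_ /andP[b' aq']]].
  apply: (IHq f f' q' (tgt FG e) (tgt FG e')).
  + rewrite [LHS]surjective_pairing [RHS]surjective_pairing; congr (_, _).
      move: b b' c.
    by rewrite /bicoloured /=; do 4!case: is_inl.
    exact: etrans ef (etrans tt (esym ef')).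
  + by apply/and3P; split=> //; apply/andP; split=> //; apply/eqP.
  + by apply/and3P; split=> //; apply/andP; split=> //; apply/eqP.
Qed.

(** The starting vertex fixes the colour of the first edge, and [altwalk_key] does the rest. *)
Lemma altwalk_unique u p v p' v' : u \in ends -> v \in ends -> v' \in ends ->
  altwalk u p v -> altwalk u p' v' -> map key p = map key p'.
Proof.
move=> uE vE v'E; case: p => [|e q]; first by case/and3P.
case: p' => [|e' q']; first by move=> _ /and3P[].
move=> aw aw'; apply: altwalk_key (aw) (aw') => //.
move: aw aw' => /andP[/andP[/eqP eu _] _] /andP[/andP[/eqP eu' _] _].
rewrite [LHS]surjective_pairing [RHS]surjective_pairing; congr (_, _).
  by rewrite (end_colour uE (or_introl eu)) (end_colour uE (or_introl eu')).
exact: etrans eu (esym eu').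
Qed.

Lemma walk_last u p v : walk u p v -> v = last u (map snd (map key p)).
Proof. by elim: p u => [u /eqP|e p IHp u /andP[_ /IHp]] //=. Qed.

Lemma altwalk_same_key u p q v : map key p = map key q ->
  altwalk u p v = altwalk u q v.
Proof.
move=> pq; rewrite /altwalk (edge_key_walk _ _ pq) (edge_key_alternating_path pq).
by rewrite -!size_eq0 -!(size_map key) pq.
Qed.

Lemma walk_rcons u p e v : walk u (rcons p e) v = walk u p (src FG e) && (tgt FG e == v).
Proof.
elim: p u => [|f p IHp] u /=; first by rewrite eq_sym.
by rewrite IHp andbA.
Qed.

Lemma altwalk_rev (r : T -> T) u p v :
  (forall e, key (r e) = ((key e).1.1, (key e).2, (key e).1.2)) ->
  altwalk u p v -> altwalk v (rev (map r p)) u.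
Proof.
move=> rP /andP[wp /andP[p0 ap]]; apply/and3P; split.
- elim: p u wp {p0 ap} => [|e p IHp] u; first by rewrite /= eq_sym.
  have [_ s t] := rP e.
  move=> /andP[/eqP <- /IHp wp].
  by rewrite map_cons rev_cons walk_rcons (s : src FG (r e) = _) wp; apply/eqP.
- by rewrite -size_eq0 size_rev size_map size_eq0.
- rewrite /alternating_path rev_sorted.
  rewrite -[X in is_true X]/(sorted (fun e f => bicoloured f e) (map r p)) sorted_map.
  apply: sub_sorted ap => e f; rewrite /relpre/= /bicoloured eq_sym.
  by have [-> _ _] := rP e; have [-> _ _] := rP f.
Qed.

(* A closed path would have the same keys as its reversal: in odd length its
   middle edge would be a loop, and in even length its two middle edges would
   have the same colour. *)
Lemma altwalk_not_closed u p : u \in ends -> ~ altwalk u p u.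
Proof.
move=> uE up; have [r rP] := choice key_rev.
have rkey e : key (r e) = ((key e).1.1, (key e).2, (key e).1.2) by case: (rP e).
have pr := altwalk_unique uE uE uE up (altwalk_rev rkey up).
case: p => [|e0 p'] in up pr *; first by case/and3P: up.
set p := e0 :: p' in up pr *.
(* Position by position, each key is the reverse of the key at the mirror position. *)
have nthE i : (i < size p)%N ->
    key (nth e0 p i) = key (r (nth e0 p (size p - i.+1))).
  move=> ip; rewrite -(nth_map e0 (key e0) key ip) pr.
  rewrite (nth_map e0) ?size_rev ?size_map// nth_rev ?size_map//.
  by rewrite (nth_map e0)// -subSn// subSS leq_subr.
case/and3P: up => _ _ ap; have nE := odd_double_half (size p).
have [od|ev] := boolP (odd (size p)).
  have hp : (size p - (size p)./2.+1 = (size p)./2)%N.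
    by rewrite -[X in (X - _)%N]nE od -addnn; lia.
  have ip : ((size p)./2 < size p)%N by rewrite -[ltnRHS]nE od -addnn; lia.
  have := nthE _ ip; rewrite hp rkey => /(congr1 (fun k => k.1.2)).
  exact: key_loop.
have s0 : (0 < (size p)./2)%N.
  by rewrite half_gt0; move: ev; rewrite /p /=; case: p' {pr ap nthE nE p}.
(* The two middle positions are [i] and [i.+1], mirror images of each other. *)
pose i := (size p)./2.-1.
have iE : (size p = i.+1 + i.+1)%N.
  by rewrite -[LHS]nE (negPf ev) -addnn /i prednK.
have ip : (i < size p)%N by rewrite iE; lia.
have := nthE i ip; rewrite rkey (_ : size p - i.+1 = i.+1)%N; last by rewrite iE; lia.
move=> /(congr1 (fun k => k.1.1)) /= c.
have ip1 : (i.+1 < size p)%N by rewrite iE; lia.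
by move/(sortedP e0): ap => /(_ i ip1); rewrite /bicoloured c eqxx.
Qed.

(** By uniqueness, the edges of the execution from [u] to [v] are exactly the sequences with the
    keys of [p], and their weights sum to a product by [esum_path_wgt]. *)
Lemma exec_total u p v : u \in ends -> v \in ends -> altwalk u p v ->
  total_wgt (gexec F G) u v = (\prod_(k <- map key p) key_wgt F G k)%E.
Proof.
move=> uE vE upv; rewrite -esum_path_wgt /total_wgt.
rewrite (reindex_esum (between (gexec F G) u v) _ (fun x => (val x).1.2))//.
split=> [x [xu xv]|x y|q /= qp].
- apply: (altwalk_unique uE vE vE _ upv).
  by rewrite -xu -xv; exact: (valP x).
- rewrite !inE => -[xu xv] [yu yv] xy; apply: val_inj.
  case: x xu xv xy => -[[a q] b] xP /= xu xv; case: y yu yv => -[[a' q'] b'] yP /= yu yv.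
  move=> ->; congr (_, _, _); apply: val_inj.
    exact: etrans xu (esym yu).
  exact: etrans xv (esym yv).
- have xP : altwalk u q v by rewrite (altwalk_same_key _ _ qp).
  by exists (exist _ ([` uE]%fset, q, [` vE]%fset) xP).
Qed.

Lemma exec_altwalk (x : edges (gexec F G)) :
  [/\ src _ x \in ends, tgt _ x \in ends &
      altwalk (src (gexec F G) x) (val x).1.2 (tgt (gexec F G) x)].
Proof. by split; [exact: src_in|exact: tgt_in|exact: (valP x)]. Qed.

Lemma exec_matching : matching (gexec F G).
Proof.
split=> [x y xy|x|x|x loop].
- have [sx tx wx] := exec_altwalk x; have [sy ty wy] := exec_altwalk y.
  rewrite -xy in wy; have pq := altwalk_unique sx tx ty wx wy.
  have /andP[/walk_last -> _] := wx; have /andP[/walk_last -> _] := wy.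
  by rewrite pq.
- have [sx tx wx] := exec_altwalk x; have [r rP] := choice key_rev.
  have rkey e : key (r e) = ((key e).1.1, (key e).2, (key e).1.2) by case: (rP e).
  have wy := altwalk_rev rkey wx.
  pose y : edges (gexec F G) := exist _ ([` tx]%fset, _, [` sx]%fset) wy.
  have sy : src (gexec F G) y = tgt (gexec F G) x by [].
  have ty : tgt (gexec F G) y = src (gexec F G) x by [].
  exists y; split => //; rewrite sy ty (exec_total tx sx wy) (exec_total sx tx wx).
  rewrite !big_map (perm_big (map r (val x).1.2)) /=; last by rewrite perm_rev.
  rewrite big_map.
  by apply: eq_bigr => e _; case: (rP e).
- have [sx tx wx] := exec_altwalk x; rewrite (exec_total sx tx wx) big_map.
  (* The set of the values 1 and [+oo] is closed under products. *)
  elim: (_.1.2) => [|e p IHp]; first by left; rewrite big_nil.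
  by rewrite big_cons; case: (key_wgt1y e) IHp => -> [] ->;
    rewrite ?mule1 ?mul1e ?mulyy; [left|right|right|right].
- by have [sx tx] := exec_altwalk x; rewrite -loop => /(altwalk_not_closed sx).
Qed.

Lemma meas_matching : meas F G <> +oo%E -> meas F G = 0%E.
Proof.
move=> fin; rewrite /meas (_ : @Cycl U R F G = set0) ?esum_set0//.
rewrite -subset0 => C [c [_ ac _]]; apply: fin; apply: meas_pinfty ac _ => e.
by case: (key_wgt1y e) => ->; rewrite ?leey.
Qed.

End Execution.

(** * Success of the composition *)

Lemma successful_pexec (U : choiceType) (R : realType) (f g : project U R)
    (fg : pmeas f g <> +oo%E) :
  successful f -> successful g -> successful (pexec fg).
Proof.
move=> sf sg; have mf := successful_matching sf; have mg := successful_matching sg.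
have [sym cube tr] := matching_success (exec_matching mf mg).
split=> //=; case: sf sg => wf _ _ _ [wg _ _ _].
(* Both wagers are 0, so the new wager is the measurement of the graphs, which is finite and
   therefore 0. *)
have mE : pmeas f g = meas (pgraph f) (pgraph g) by rewrite /pmeas wf wg !add0e.
by rewrite mE (meas_matching mf mg)// -mE.
Qed.

Theorem mainTheorem5 (U : choiceType) (R : realType) (VA VB : {fset U})
    (A B : projects U R) (f a : project U R)
    (conductA : conduct VA A) (conductB : conduct VB B)
    (disjAB : [disjoint VA & VB]%fset)
    (f_in : lollipop A B f) (f_succ : successful f)
    (a_in : A a) (a_succ : successful a) :
  exists fa : pmeas f a <> +oo%E, successful (pexec fa).
Proof. by have [fa _] := f_in a a_in; exists fa; apply: successful_pexec. Qed.
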